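(* (Soundness for orthogonal scaled dyadic matrices.) Let $n\geq 2$ be even and let $\mathbf{G}$ and $\mathbf{H}$ be words over $\mathcal{F}_n$. If $\mathbf{G}\approx\mathbf{H}$ (i.e. one can be rewritten into the other using the relations listed in the context), then $\mathbf{G}\sim\mathbf{H}$ (i.e. $\mathbf{G}$ and $\mathbf{H}$ denote the same matrix in $\mathcal{L}_n$).
   Context: $\mathcal{L}_n$ denotes the group of $n\times n$ orthogonal matrices of the form $M/\sqrt2^{\,k}$ with $M$ an integer matrix and $k$ a nonnegative integer. Let $X=\begin{bmatrix}0&1\\1&0\end{bmatrix}$, $H=\frac1{\sqrt2}\begin{bmatrix}1&1\\1&-1\end{bmatrix}$ and $K=H\otimes H=\frac12\begin{bmatrix}1&1&1&1\\1&-1&1&-1\\1&1&-1&-1\\1&-1&-1&1\end{bmatrix}$. For an $m\times m$ matrix $M$ and distinct $a_1,\dots,a_m\in\{1,\dots,n\}$, $M_{[a_1,\dots,a_m]}$ is the $n\times n$ matrix whose $(a_{i'},a_{j'})$ entry is $M_{i',j'}$ and whose other entries are those of the identity. For $n$ even, $I\otimes H=I_{n/2}\otimes H=\mathrm{diag}(H,\dots,H)$ ($n\times n$ block-diagonal). The set of generators is $\mathcal{F}_n=\{(-1)_{[a]},X_{[a,b]},K_{[a,b,c,d]},I\otimes H\mid 1\leq a<b<c<d\leq n\}$ (each type of indexed generator is included whenever its own indices are increasing and in $\{1,\dots,n\}$). A word over $\mathcal{F}_n$ is a finite sequence of generators, $\epsilon$ is the empty word; a word $G_1\ldots G_m$ is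 interpreted as the matrix product $G_1\cdots G_m$. $\mathbf{V}\sim\mathbf{W}$ means that $\mathbf{V}$ and $\mathbf{W}$ have the same interpretation. $\approx$ is the smallest congruence (equivalence relation compatible with concatenation) on words over $\mathcal{F}_n$ containing the following relations, where in each relation the indices named by distinct letters are distinct elements of $\{1,\dots,n\}$ and the relation is well-formed (all indexed generators occurring in it have increasing indices in $\{1,\dots,n\}$): (1) $X_{[a,b]}^2\approx\epsilon$; $(-1)_{[a]}^2\approx\epsilon$; $K_{[a,b,c,d]}^2\approx\epsilon$. (2) $X_{[a,b]}X_{[c,d]}\approx X_{[c,d]}X_{[a,b]}$; $X_{[a,b]}(-1)_{[c]}\approx(-1)_{[c]}X_{[a,b]}$; $X_{[a,b]}K_{[c,d,e,f]}\approx K_{[c,d,e,f]}X_{[a,b]}$; $(-1)_{[a]}(-1)_{[b]}\approx(-1)_{[b]}(-1)_{[a]}$; $(-1)_{[a]}K_{[b,c,d,e]}\approx K_{[b,c,d,e]}(-1)_{[a]}$; $K_{[a,b,c,d]}K_{[e,f,g,h]}\approx K_{[e,f,g,h]}K_{[a,b,c,d]}$. (3) $X_{[a,a']}X_{[a,b]}\approx X_{[a',b]}X_{[a,a']}$; $X_{[b,b']}X_{[a,b]}\approx X_{[a,b']}X_{[b,b']}$; $X_{[a,b]}(-1)_{[b]}\approx(-1)_{[a]}X_{[a,b]}$; $X_{[a,a']}K_{[a,b,c,d]}\approx K_{[a',b,c,d]}X_{[a,a']}$; $X_{[b,b']}K_{[a,b,c,d]}\approx K_{[a,b',c,d]}X_{[b,b']}$;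 $X_{[c,c']}K_{[a,b,c,d]}\approx K_{[a,b,c',d]}X_{[c,c']}$; $X_{[d,d']}K_{[a,b,c,d]}\approx K_{[a,b,c,d']}X_{[d,d']}$. (4) $X_{[a,b]}K_{[a,b,c,d]}\approx K_{[a,b,c,d]}X_{[b,d]}(-1)_{[b]}(-1)_{[d]}$; $X_{[b,c]}K_{[a,b,c,d]}\approx(-1)_{[a]}K_{[a,b,c,d]}(-1)_{[a]}K_{[a,b,c,d]}(-1)_{[a]}$; $X_{[c,d]}K_{[a,b,c,d]}\approx K_{[a,b,c,d]}X_{[b,d]}$. (5) $K_{[a,b,c,d]}K_{[b,d,e,f]}\approx K_{[c,d,e,f]}K_{[a,b,c,e]}$ (for $a<b<c<d<e<f$). (6) $(-1)_{[a]}(-1)_{[e]}X_{[a,e]}\,\mathbf{M}\,X_{[a,e]}(-1)_{[a]}(-1)_{[e]}\approx\mathbf{M}$, where $\mathbf{M}$ is the word $K_{[e,f,g,h]}K_{[a,b,c,d]}X_{[d,e]}K_{[a,b,c,d]}K_{[e,f,g,h]}$ (for $a<b<\dots<h$). (7) $(I\otimes H)^2\approx\epsilon$; $(I\otimes H)K_{[1,2,3,4]}(I\otimes H)\approx K_{[1,2,3,4]}$ (when $n\geq4$); $(I\otimes H)(-1)_{[1]}(I\otimes H)\approx(-1)_{[1]}X_{[1,2]}(-1)_{[1]}$; and for $1\leq a\leq n-1$, $(I\otimes H)X_{[a,a+1]}(I\otimes H)\approx(-1)_{[a+1]}$ if $a$ is odd, and $(I\otimes H)X_{[a,a+1]}(I\otimes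 H)\approx X_{[a,a+1]}K_{[a-1,a,a+1,a+2]}$ if $a$ is even. *)

(* Defs.v *)
From HB Require Import structures.
From mathcomp Require Import all_boot all_order all_algebra.
From mathcomp Require Import reals.
From mathcomp.real_closed Require Import mxtens.
Set Implicit Arguments.
Unset Strict Implicit.
Unset Printing Implicit Defensive.
Import Order.TTheory GRing.Theory Num.Theory.
Local Open Scope ring_scope.

(* Indices of generators are the natural numbers 1, ..., n, as on paper; index
   a designates the row or column of a matrix whose ordinal i : 'I_n satisfies
   i.+1 = a. *)

Section Matrices.

Variable R : rcfType.

Definition sqrt2 : R := Num.sqrt 2.

Definition in_L n (A : 'M[R]_n) : Prop :=
  A *m A^T = 1%:M /\
  exists (k : nat) (M : 'M[int]_n), A = (sqrt2 ^+ k)^-1 *: map_mx intr M.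

Definition mx_of_rows m n (rows : seq (seq R)) : 'M[R]_(m, n) :=
  \matrix_(i < m, j < n) (nth [::] rows i)`_j.

Definition Xmx : 'M[R]_2 := mx_of_rows 2 2 [:: [:: 0; 1]; [:: 1; 0]].
Definition Hmx : 'M[R]_2 :=
  sqrt2^-1 *: mx_of_rows 2 2 [:: [:: 1; 1]; [:: 1; -1]].
Definition Kmx : 'M[R]_4 := Hmx *t Hmx.

(* M_[a_1, ..., a_m] *)
Definition embed_mx n m (M : 'M[R]_m) (a : m.-tuple nat) : 'M[R]_n :=
  \matrix_(i < n, j < n)
    match [pick p : 'I_m | tnth a p == i.+1],
          [pick q : 'I_m | tnth a q == j.+1] with
    | Some p, Some q => M p q
    | _, _ => (i == j)%:R
    end.

(* The tensor product has size n./2 * 2, which is n for n even; conform_mx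
   only identifies these two sizes (its default value is reached for odd n). *)
Definition IHmx n : 'M[R]_n :=
  conform_mx (0 : 'M[R]_n) ((1%:M : 'M[R]_n./2) *t Hmx).

End Matrices.

Inductive pregen : Type :=
  | Neg of nat
  | X of nat & nat
  | K of nat & nat & nat & nat
  | IH.

Definition indices (g : pregen) : seq nat :=
  match g with
  | Neg a => [:: a]
  | X a b => [:: a; b]
  | K a b c d => [:: a; b; c; d]
  | IH => [::]
  end.

Definition wf_gen (n : nat) (g : pregen) : bool :=
  sorted ltn (indices g) && all (fun a => (1 <= a <= n)%N) (indices g).

Definition generator (n : nat) : Type := {g : pregen | wf_gen n g}.
Definition word (n : nat) : Type := seq (generator n).

Section Interpretation.

Variables (R : rcfType) (n : nat).

Definition gen_mx (g : pregen) : 'M[R]_n :=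
  match g with
  | Neg a => embed_mx n (-1)%:M [tuple a]
  | X a b => embed_mx n (Xmx R) [tuple a; b]
  | K a b c d => embed_mx n (Kmx R) [tuple a; b; c; d]
  | IH => IHmx R n
  end.

Definition word_mx (W : word n) : 'M[R]_n := \prod_(g <- W) gen_mx (val g).

Definition same_mx (V W : word n) : Prop := word_mx V = word_mx W.

End Interpretation.

Definition KKXKK (a b c d e f g h : nat) : seq pregen :=
  [:: K e f g h; K a b c d; X d e; K a b c d; K e f g h].

Inductive relation : seq pregen -> seq pregen -> Prop :=
  | rel_XX a b : uniq [:: a; b] -> relation [:: X a b; X a b] [::]
  | rel_NN a : relation [:: Neg a; Neg a] [::]
  | rel_KK a b c d : uniq [:: a; b; c; d] ->
      relation [:: K a b c d; K a b c d] [::]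
  | rel_XX_comm a b c d : uniq [:: a; b; c; d] ->
      relation [:: X a b; X c d] [:: X c d; X a b]
  | rel_XN_comm a b c : uniq [:: a; b; c] ->
      relation [:: X a b; Neg c] [:: Neg c; X a b]
  | rel_XK_comm a b c d e f : uniq [:: a; b; c; d; e; f] ->
      relation [:: X a b; K c d e f] [:: K c d e f; X a b]
  | rel_NN_comm a b : uniq [:: a; b] ->
      relation [:: Neg a; Neg b] [:: Neg b; Neg a]
  | rel_NK_comm a b c d e : uniq [:: a; b; c; d; e] ->
      relation [:: Neg a; K b c d e] [:: K b c d e; Neg a]
  | rel_KK_comm a b c d e f g h : uniq [:: a; b; c; d; e; f; g; h] ->
      relation [:: K a b c d; K e f g h] [:: K e f g h; K a b c d]
  | rel_XX_fst a a' b : uniq [:: a; a'; b] ->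
      relation [:: X a a'; X a b] [:: X a' b; X a a']
  | rel_XX_snd a b b' : uniq [:: a; b; b'] ->
      relation [:: X b b'; X a b] [:: X a b'; X b b']
  | rel_XN a b : uniq [:: a; b] ->
      relation [:: X a b; Neg b] [:: Neg a; X a b]
  | rel_XK_1 a a' b c d : uniq [:: a; a'; b; c; d] ->
      relation [:: X a a'; K a b c d] [:: K a' b c d; X a a']
  | rel_XK_2 a b b' c d : uniq [:: a; b; b'; c; d] ->
      relation [:: X b b'; K a b c d] [:: K a b' c d; X b b']
  | rel_XK_3 a b c c' d : uniq [:: a; b; c; c'; d] ->
      relation [:: X c c'; K a b c d] [:: K a b c' d; X c c']
  | rel_XK_4 a b c d d' : uniq [:: a; b; c; d; d'] ->
      relation [:: X d d'; K a b c d] [:: K a b c d'; X d d']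
  | rel_K_12 a b c d : uniq [:: a; b; c; d] ->
      relation [:: X a b; K a b c d] [:: K a b c d; X b d; Neg b; Neg d]
  | rel_K_23 a b c d : uniq [:: a; b; c; d] ->
      relation [:: X b c; K a b c d]
               [:: Neg a; K a b c d; Neg a; K a b c d; Neg a]
  | rel_K_34 a b c d : uniq [:: a; b; c; d] ->
      relation [:: X c d; K a b c d] [:: K a b c d; X b d]
  | rel_KK_overlap a b c d e f : sorted ltn [:: a; b; c; d; e; f] ->
      relation [:: K a b c d; K b d e f] [:: K c d e f; K a b c e]
  | rel_KXK_comm a b c d e f g h : sorted ltn [:: a; b; c; d; e; f; g; h] ->
      relation ([:: Neg a; Neg e; X a e] ++ KKXKK a b c d e f g h
                  ++ [:: X a e; Neg a; Neg e])
               (KKXKK a b c d e f g h)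
  | rel_IHIH : relation [:: IH; IH] [::]
  | rel_IHK : relation [:: IH; K 1 2 3 4; IH] [:: K 1 2 3 4]
  | rel_IHN : relation [:: IH; Neg 1; IH] [:: Neg 1; X 1 2; Neg 1]
  | rel_IHX_odd a : odd a -> relation [:: IH; X a a.+1; IH] [:: Neg a.+1]
  | rel_IHX_even a : ~~ odd a ->
      relation [:: IH; X a a.+1; IH] [:: X a a.+1; K a.-1 a a.+1 a.+2].

(* Relations are taken between words of generators, so that only their
   well-formed instances (indices increasing and in {1, ..., n}) count. *)
Inductive equiv_word (n : nat) : word n -> word n -> Prop :=
  | equiv_rel V W : relation (map val V) (map val W) -> equiv_word V W
  | equiv_refl V : equiv_word V V
  | equiv_sym V W : equiv_word V W -> equiv_word W V
  | equiv_trans U V W : equiv_word U V -> equiv_word V W -> equiv_word U W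
  | equiv_cat V V' W W' :
      equiv_word V V' -> equiv_word W W' -> equiv_word (V ++ W) (V' ++ W').

Section Facts.

Variable R : rcfType.
Local Notation sqrt2 := (sqrt2 R).

Lemma sqrt2_neq0 : sqrt2 != 0.
Proof. by rewrite sqrtr_eq0 -ltNge ltr0n. Qed.

Lemma sqrt2V2 : sqrt2^-1 * sqrt2^-1 = 2^-1.
Proof. by rewrite -invfM -expr2 sqr_sqrtr ?ler0n. Qed.

Lemma sqr_sqrt2 : sqrt2 ^+ 2 = 2.
Proof. by rewrite sqr_sqrtr ?ler0n. Qed.

Lemma KmxE : Kmx R = 2^-1 *: mx_of_rows 4 4
  [:: [:: 1;  1;  1;  1];
      [:: 1; -1;  1; -1];
      [:: 1;  1; -1; -1];
      [:: 1; -1; -1;  1]].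
Proof.
apply/matrixP=> i j; rewrite !mxE /= mulrACA sqrt2V2; congr (_ * _).
by case: i => [[|[|[|[|i]]]] //= Hi]; case: j => [[|[|[|[|j]]]] //= Hj];
  rewrite ?mulr1 ?mul1r ?mulrNN ?mulr1.
Qed.


Lemma IHmxP n (P : forall n : nat, 'M[R]_n -> Prop) :
  ~~ odd n -> (forall m, P (m * 2)%N (1%:M *t Hmx R)) -> P n (IHmx R n).
Proof.
move=> En PH; rewrite /IHmx; have := PH n./2.
have: (n./2 * 2)%N = n by rewrite muln2 even_halfK.
move: (1%:M *t _); move: (n./2 * 2)%N => m A e.
by case: n / e in En *; rewrite conform_mx_id.
Qed.

Lemma IHmxE n : ~~ odd n -> forall i j : 'I_n,
  IHmx R n i j = (i./2 == j./2)%:R * Hmx R (inord (odd i)) (inord (odd j)).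
Proof.
move/(@IHmxP n (fun n A => forall i j, A i j =
  (i./2 == j./2)%:R * Hmx R (inord (odd i)) (inord (odd j)))); apply.
move=> m i j; rewrite [LHS]mxE mxE -val_eqE /= !divn2.
by congr (_ * Hmx R _ _); apply: val_inj; rewrite /= modn2 inordK //; case: odd.
Qed.

Lemma Hmx_orth : Hmx R *m (Hmx R)^T = 1%:M.
Proof.
apply/matrixP=> i j; rewrite !mxE !big_ord_recl big_ord0 !mxE addr0.
have h : 2^-1 + 2^-1 = 1 :> R.
  by rewrite -mulr2n -[_ *+ 2]mulr_natl divff ?pnatr_eq0.
by case: i => [[|[|i]] //= Hi]; case: j => [[|[|j]] //= Hj];
  rewrite /= ?(mulr1, mulrN1, mulrNN, mulrN, mulNr) ?sqrt2V2 ?subrr ?h.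
Qed.

Lemma tens_orth m n (A : 'M[R]_m) (B : 'M[R]_n) :
  A *m A^T = 1%:M -> B *m B^T = 1%:M -> (A *t B) *m (A *t B)^T = 1%:M.
Proof.
move=> hA hB; rewrite trmx_tens tensmx_mul hA hB; apply/matrixP=> i j.
case: (mxtens_indexP i) => i1 i2; case: (mxtens_indexP j) => j1 j2.
rewrite tensmxE !mxE -natrM mulnb (inj_eq (can_inj (@mxtens_indexK m n))).
by rewrite xpair_eqE.
Qed.

Definition scaled_entries n (A : 'M[R]_n) k :=
  forall i j, exists z : int, A i j = (sqrt2 ^+ k)^-1 * z%:~R.

Lemma in_L_entries n (A : 'M[R]_n) k :
  A *m A^T = 1%:M -> scaled_entries A k -> in_L A.
Proof.
move=> hA hE; split=> //; exists k.
have hb i j : exists z : int, A i j == (sqrt2 ^+ k)^-1 * z%:~R.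
  by have [z ->] := hE i j; exists z.
exists (\matrix_(i, j) xchoose (hb i j)).
by apply/matrixP=> i j; rewrite !mxE; apply/eqP; exact: (xchooseP (hb i j)).
Qed.

Lemma in_L1 n : in_L (1%:M : 'M[R]_n).
Proof.
apply: (@in_L_entries _ _ 0); first by rewrite trmx1 mulmx1.
by move=> i j; exists ((i == j)%:Z); rewrite expr0 invr1 mul1r mxE.
Qed.

Lemma in_LM n (A B : 'M[R]_n) : in_L A -> in_L B -> in_L (A *m B).
Proof.
move=> [hA [k [M eA]]] [hB [l [N eB]]]; split.
  by rewrite trmx_mul mulmxA -(mulmxA A) hB mulmx1.
exists (k + l)%N, (M *m N).
by rewrite eA eB -scalemxAl -scalemxAr scalerA map_mxM exprD invfM.
Qed.

Section Embedding.

Variables (n m : nat) (a : m.-tuple nat).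
Hypotheses (ua : uniq a) (ha : all (fun x => (1 <= x <= n)%N) a).

Lemma emb_ord_subproof (p : 'I_m) : ((tnth a p).-1 < n)%N.
Proof.
by have /andP[] := allP ha _ (mem_tnth p a); case: (tnth a p).
Qed.

Definition emb_ord (p : 'I_m) : 'I_n := Ordinal (emb_ord_subproof p).

Lemma emb_ordS p : (emb_ord p).+1 = tnth a p.
Proof. by have /andP[/= h _] := allP ha _ (mem_tnth p a); rewrite prednK. Qed.

Lemma emb_ord_inj : injective emb_ord.
Proof.
move=> p q e; apply: (tuple_uniqP _ ua).
by rewrite -!emb_ordS e.
Qed.

Lemma emb_pick p : [pick p' : 'I_m | tnth a p' == (emb_ord p).+1] = Some p.
Proof.
case: pickP => [q /eqP|/(_ p)]; last by rewrite emb_ordS eqxx.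
by rewrite emb_ordS => /(tuple_uniqP _ ua) ->.
Qed.

Variant emb_spec (i : 'I_n) : option 'I_m -> Prop :=
  | EmbIn p of i = emb_ord p : emb_spec i (Some p)
  | EmbOut of (forall p, i != emb_ord p) : emb_spec i None.

Lemma embP i : emb_spec i [pick p : 'I_m | tnth a p == i.+1].
Proof.
case: pickP => [p /eqP e|h]; constructor.
  by apply/val_inj/eqP; rewrite -eqSS emb_ordS e.
by move=> p; apply/eqP=> e; have := h p; rewrite e emb_ordS eqxx.
Qed.

Lemma embed_mxM (A B : 'M[R]_m) :
  embed_mx n A a *m embed_mx n B a = embed_mx n (A *m B) a.
Proof.
apply/matrixP=> i j; rewrite !mxE.
case: (embP i) => [p ei|hi]; last first.
  rewrite (bigD1 i) //= big1 ?addr0 => [|k nk]; rewrite !mxE.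
    case: (embP i) => [p e|_]; first by have := hi p; rewrite e eqxx.
    by rewrite eqxx mul1r.
  case: (embP i) => [p e|_]; first by have := hi p; rewrite e eqxx.
  by rewrite eq_sym (negbTE nk) mul0r.
rewrite (bigID [in codom emb_ord]) /= [X in _ + X]big1 ?addr0; last first.
  move=> k nk; rewrite !mxE ei emb_pick.
  case: (embP k) => [q e|_]; first by rewrite e codom_f in nk.
  case: eqP => [e|_]; last by rewrite mul0r.
  by rewrite -e codom_f in nk.
rewrite (reindex emb_ord) /=; last first.
  exists (fun k => odflt p [pick p : 'I_m | tnth a p == k.+1]) => [q _|k].
    by rewrite emb_pick.
  by move=> /codomP[q ->]; rewrite emb_pick.
under eq_bigl => q do rewrite codom_f.
case: (embP j) => [q ej|hj].
  rewrite mxE; apply: eq_bigr => r _.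
  by rewrite !mxE ei ej !emb_pick.
rewrite big1 ?ei => [|r _].
  by case: eqP => // e; have := hj p; rewrite e eqxx.
rewrite !mxE !emb_pick; case: (embP j) => [q e|_].
  by have := hj q; rewrite e eqxx.
by case: eqP => [e|_]; [have := hj r; rewrite e eqxx|rewrite mulr0].
Qed.

Lemma embed_mx1 : embed_mx n (1%:M : 'M[R]_m) a = 1%:M.
Proof.
apply/matrixP=> i j; rewrite !mxE.
case: (embP i) => [p ->|//]; case: (embP j) => [q ->|//].
by rewrite mxE (inj_eq emb_ord_inj).
Qed.

Lemma embed_mxT (A : 'M[R]_m) : (embed_mx n A a)^T = embed_mx n A^T a.
Proof.
apply/matrixP=> i j; rewrite !mxE eq_sym.
by do 2 case: pickP => //= *; rewrite ?mxE.
Qed.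

Lemma embed_in_L (A : 'M[R]_m) k : ~~ odd k ->
  A *m A^T = 1%:M -> scaled_entries A k -> in_L (embed_mx n A a).
Proof.
move=> ek hA hE; apply: (@in_L_entries _ _ k).
  by rewrite embed_mxT embed_mxM hA embed_mx1.
have hd (b : bool) : exists z : int, b%:R = (sqrt2 ^+ k)^-1 * z%:~R.
  exists (b%:Z * 2 ^+ k./2).
  rewrite -{1}(even_halfK ek) -muln2 mulnC exprM sqr_sqrt2 intrM rmorphXn /=.
  by rewrite mulrCA mulVf ?mulr1 // expf_neq0 // pnatr_eq0.
by move=> i j; rewrite mxE; do 2 case: pickP => // *.
Qed.

End Embedding.

Lemma gen_in_L n (g : pregen) : ~~ odd n -> wf_gen n g -> in_L (gen_mx R n g).
Proof.
move=> En /andP[ho hi].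
have ui : uniq (indices g) by exact: (sorted_uniq ltn_trans ltnn ho).
case: g hi ui {ho} => [a|a b|a b c d|] hi ui /=.
- apply: (@embed_in_L _ _ [tuple a] ui hi _ 0) => //.
    by rewrite tr_scalar_mx -scalar_mxM mulrNN mulr1.
  by move=> i j; exists (-1); rewrite !ord1 mxE expr0 invr1 mul1r.
- apply: (@embed_in_L _ _ [tuple a; b] ui hi _ 0) => //.
    apply/matrixP=> i j; rewrite !mxE !big_ord_recl big_ord0 !mxE addr0.
    by case: i => [[|[|i]] //= Hi]; case: j => [[|[|j]] //= Hj];
      rewrite ?mul0r ?mulr0 ?mulr1 ?addr0 ?add0r.
  move=> i j; exists ((i != j)%:Z); rewrite expr0 invr1 mul1r mxE.
  by case: i => [[|[|i]] //= Hi]; case: j => [[|[|j]] //= Hj].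
- apply: (@embed_in_L _ _ [tuple a; b; c; d] ui hi _ 2) => //.
    exact: (tens_orth Hmx_orth Hmx_orth).
  move=> i j; rewrite KmxE mxE sqr_sqrt2 mxE.
  case: i => [[|[|[|[|i]]]] //= Hi]; case: j => [[|[|[|[|j]]]] //= Hj];
    by [exists 1|exists (-1)].
- apply: (@IHmxP _ (fun n A => in_L A)) => // m.
  apply: (@in_L_entries _ _ 1).
    by apply: tens_orth; [rewrite trmx1 mulmx1|exact: Hmx_orth].
  move=> i j; rewrite !mxE expr1 /= mulrCA.
  set u := (_ == _); set p := ((i %% 2)%N); set q := ((j %% 2)%N).
  exists (u%:Z * (if (p == 1%N) && (q == 1%N) then -1 else 1)).
  rewrite intrM; congr (_ * (_ * _)).
  rewrite /p /q !modn2; by case: odd; case: odd.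
Qed.

Lemma word_in_L n (W : word n) : ~~ odd n -> in_L (word_mx R W).
Proof.
move=> En; rewrite /word_mx; elim: W => [|g W IH_W].
  by rewrite big_nil; exact: in_L1.
by rewrite big_cons; apply: in_LM => //; apply: gen_in_L => //; exact: (valP g).
Qed.

End Facts.

(* Main.v *)
(** A matrix is determined by its action on vectors. A generator touches at
    most four coordinates of a vector, or (for [I (x) H]) combines the two
    coordinates of each consecutive pair, so its action has an explicit formula
    in terms of 1-based coordinates. Each relation then becomes an identity
    between linear combinations of finitely many coordinates, once the output
    coordinate has been compared with every index occurring in the relation. *)

Require Import Defs.
From mathcomp Require Import all_boot all_order all_algebra.
From mathcomp Require Import reals.
From mathcomp Require Import ring lra zify.

Set Implicit Arguments.
Unset Strict Implicit.
Unset Printing Implicit Defensive.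
Import Order.TTheory GRing.Theory Num.Theory.
Local Open Scope ring_scope.

(** * Embedded matrices acting on vectors in 1-based coordinates *)

Section EmbeddedAction.

Variables (R : rcfType) (n m : nat) (a : m.-tuple nat).
Hypotheses (ua : uniq a) (ha : all (fun x => (1 <= x <= n)%N) a).

Lemma embed_mx_sum_in (M : 'M[R]_m) (v : nat -> R) (p : 'I_m) :
  \sum_j embed_mx n M a (emb_ord ha p) j * v j.+1
    = \sum_q M p q * v (tnth a q).
Proof.
rewrite (bigID [in [set emb_ord ha q | q : 'I_m]]) /=.
rewrite [X in _ + X]big1 ?addr0 => [|j].
  rewrite big_imset /=; last by move=> q r _ _; exact: emb_ord_inj.
  apply: eq_big => [q|q _]; first by rewrite inE.
  by rewrite mxE !emb_pick // -[in RHS](emb_ordS ha).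
rewrite mxE emb_pick //; case: (embP ha j) => [q ->|hj _].
  by rewrite imset_f.
by rewrite eq_sym (negbTE (hj p)) mul0r.
Qed.

Lemma embed_mx_sum_out (M : 'M[R]_m) (v : nat -> R) (i : 'I_n) :
  (forall p, i != emb_ord ha p) ->
  \sum_j embed_mx n M a i j * v j.+1 = v i.+1.
Proof.
move=> hi; have e j : embed_mx n M a i j = (i == j)%:R.
  by rewrite mxE; case: (embP ha i) => // p e; have := hi p; rewrite e eqxx.
rewrite (bigD1 i) //= big1 ?addr0 => [|j nj]; rewrite e ?eqxx ?mul1r //.
by rewrite eq_sym (negbTE nj) mul0r.
Qed.

(** Reduces a formula [f] for the action to [m] checks at the listed indices, since every other
    coordinate is fixed. *)
Lemma embed_mx_sum (M : 'M[R]_m) (v f : nat -> R) :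
  (forall p, f (tnth a p) = \sum_q M p q * v (tnth a q)) ->
  (forall i, i \notin tval a -> f i = v i) ->
  forall i : 'I_n, \sum_j embed_mx n M a i j * v j.+1 = f i.+1.
Proof.
move=> f_in f_out i; case: (embP ha i) => [p ->|hi].
  by rewrite embed_mx_sum_in emb_ordS f_in.
rewrite embed_mx_sum_out // f_out //; apply/tnthP => -[p e].
by have /eqP := hi p; apply; apply: val_inj; apply: succn_inj; rewrite emb_ordS.
Qed.

End EmbeddedAction.

(** * The action of [IHmx] on vectors *)

Lemma Hmx_inord (R : rcfType) (b c : bool) :
  Hmx R (inord b) (inord c) = (sqrt2 R)^-1 * (-1) ^+ (b && c).
Proof.
by rewrite !mxE !inordK; case: b; case: c; rewrite //= ?expr0 ?expr1.
Qed.

(** Row [i] is supported on the two columns of its own block. The ordinal [i] is 0-based while [v]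
    is 1-based, so an odd [i] is the second row of a block. *)
Lemma IHmx_sum (R : rcfType) (n : nat) (v : nat -> R) (i : 'I_n) : ~~ odd n ->
  \sum_j IHmx R n i j * v j.+1 =
    (sqrt2 R)^-1 * (if odd i then v i - v i.+1 else v i.+1 + v i.+2).
Proof.
move=> en; have i_lt := ltn_ord i.
have h0 : (i./2.*2 < n)%N by lia.
(* Evenness of [n] keeps the second column of the last block in range. *)
have h1 : (i./2.*2.+1 < n)%N by lia.
rewrite (bigD1 (Ordinal h0)) //= (bigD1 (Ordinal h1)) //=; last first.
  by rewrite -val_eqE /=; lia.
rewrite big1 ?addr0 => [|j]; last first.
  rewrite -!val_eqE /= IHmxE // => j_ne.
  by rewrite (_ : (i./2 == j./2) = false) ?mul0r //; lia.
rewrite !IHmxE // !Hmx_inord /=.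
rewrite (_ : (i./2 == i./2.*2./2) = true); last by lia.
rewrite (_ : (i./2 == i./2.*2.+1./2) = true); last by lia.
rewrite (_ : odd i./2.*2 = false); last by lia.
rewrite /= andbF andbT; case: ifP => oi.
  rewrite (_ : i./2.*2.+1 = i :> nat); last by lia.
  rewrite expr0 expr1; ring.
rewrite (_ : i./2.*2 = i :> nat); last by lia.
rewrite expr0; ring.
Qed.

(** * Tactics evaluating coordinate formulas by cases *)

Ltac split_neqs :=
  repeat match goal with
  | H : is_true (sorted _ ?s) |- _ =>
      have ? : uniq (s : seq nat) := sorted_uniq ltn_trans ltnn H; clear H
  | H : is_true (uniq _) |- _ => rewrite /= !inE ?negb_or ?andbT in H
  | H : is_true (_ && _) |- _ => case/andP: H => ? ?
  | H : is_true (?x != ?y) |- _ =>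
      have ? : ((x : nat) == (y : nat)) = false := negbTE H;
      have ? : ((y : nat) == (x : nat)) = false by [rewrite eq_sym];
      clear H
  end.

Ltac eval_ifs :=
  repeat (
    match goal with
    | |- context [if ?x == ?x then _ else _] => rewrite (eqxx x)
    | H : ?c = false |- context [if ?c then _ else _] => rewrite H
    end; cbv beta iota).

Ltac case_letters :=
  eval_ifs;
  repeat (
    match goal with
    | |- context [if ?x == ?y then _ else _] =>
        let e := fresh "e" in
        case: (@eqVneq nat x y) => [e|?]; [rewrite ?e; clear e|split_neqs]
    end; eval_ifs).

(** Serves the relations with [IH], where indices are numerals or shifts of one letter, so that
    comparisons and parities fall to linear arithmetic. *)
Ltac decide_ifs :=
  repeat (
    match goal with
    | |- context [if ?c then _ else _] =>
        first [rewrite (_ : c = true); last lia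
              |rewrite (_ : c = false); last lia]
    end; cbv beta iota; cbn [Nat.pred]).

(** * Generators and relations as maps on coordinate functions *)

Section Action.

Variable R : rcfType.

(** Vectors live on all of [nat], so actions compose without range proofs. Positions are 1-based: an
    odd [i] is the first of its pair. *)
Definition gen_act (g : pregen) (v : nat -> R) (i : nat) : R :=
  match g with
  | Neg a => if i == a then - v a else v i
  | X a b => if i == a then v b else if i == b then v a else v i
  | K a b c d =>
      if i == a then 2^-1 * (v a + v b + v c + v d)
      else if i == b then 2^-1 * (v a - v b + v c - v d)
      else if i == c then 2^-1 * (v a + v b - v c - v d)
      else if i == d then 2^-1 * (v a - v b - v c + v d)
      else v i
  | IH => (sqrt2 R)^-1 * (if odd i then v i + v i.+1 else v i.-1 - v i)
  end.

Lemma gen_actP (n : nat) (g : pregen) (v : nat -> R) (i : 'I_n) :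
  ~~ odd n -> wf_gen n g ->
  \sum_j gen_mx R n g i j * v j.+1 = gen_act g v i.+1.
Proof.
move=> en /andP[ho hi].
have ui : uniq (indices g) by exact: (sorted_uniq ltn_trans ltnn ho).
case: g hi ui {ho} => [a|a b|a b c d|] hi ui.
- apply: (@embed_mx_sum _ _ _ [tuple a] ui hi) => [p|j] /=.
    rewrite big_ord1 !(tnth_nth 0%N) !ord1 mxE /= eqxx; ring.
  by rewrite !inE => /negbTE ->.
- apply: (@embed_mx_sum _ _ _ [tuple a; b] ui hi) => [p|j] /=.
    split_neqs.
    rewrite !big_ord_recl big_ord0 !(tnth_nth 0%N) !mxE /=.
    by case: p => [[|[|p]] //= hp]; eval_ifs; ring.
  by rewrite !inE !negb_or => ?; split_neqs; eval_ifs.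
- apply: (@embed_mx_sum _ _ _ [tuple a; b; c; d] ui hi) => [p|j] /=.
    split_neqs.
    rewrite KmxE !big_ord_recl big_ord0 !(tnth_nth 0%N) !mxE /=.
    by case: p => [[|[|[|[|p]]]] //= hp]; eval_ifs; ring.
  by rewrite !inE !negb_or => ?; split_neqs; eval_ifs.
- by rewrite [LHS]IHmx_sum //=; case: odd.
Qed.

Lemma gen_act_Neg a (v : nat -> R) i :
  gen_act (Neg a) v i = if i == a then - v a else v i.
Proof. by []. Qed.

Lemma gen_act_X a b (v : nat -> R) i :
  gen_act (X a b) v i = if i == a then v b else if i == b then v a else v i.
Proof. by []. Qed.

Lemma gen_act_K a b c d (v : nat -> R) i :
  gen_act (K a b c d) v i =
    if i == a then 2^-1 * (v a + v b + v c + v d)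
    else if i == b then 2^-1 * (v a - v b + v c - v d)
    else if i == c then 2^-1 * (v a + v b - v c - v d)
    else if i == d then 2^-1 * (v a - v b - v c + v d)
    else v i.
Proof. by []. Qed.

Lemma gen_act_IH (v : nat -> R) i :
  gen_act IH v i =
    (sqrt2 R)^-1 * (if odd i then v i + v i.+1 else v i.-1 - v i).
Proof. by []. Qed.

Ltac eval_act actN actX actK :=
  rewrite /KKXKK; cbn [cat foldr];
  repeat (first [rewrite actN | rewrite actX | rewrite actK]; case_letters);
  clear; lra.

(* The only nonlinear fact that [lra] needs is [h * h = 1/2] for
   [h = 1 / sqrt 2], multiplied by each coordinate of [v] that occurs. *)
Ltac eval_act_IH actN actX actK actIH v hhK :=
  cbn [foldr];
  repeat (first [rewrite actN | rewrite actX | rewrite actK | rewrite actIH];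
          decide_ifs);
  repeat match goal with
  | |- context [v ?j] => move: (hhK (v j)); move: (v j) => ?
  end;
  clear; intros; lra.

(* Well-formedness excludes the junk instance of [rel_IHX_even] at [a = 0]. *)
Lemma relation_act (n : nat) (U V : seq pregen) (v : nat -> R) (i : nat) :
  relation U V -> all (wf_gen n) U -> (0 < i)%N ->
  foldr gen_act v U i = foldr gen_act v V i.
Proof.
move=> r wfU i_gt0.
have hhK x : (sqrt2 R)^-1 * ((sqrt2 R)^-1 * x) = 2^-1 * x.
  by rewrite mulrA sqrt2V2.
(* With [gen_act] transparent, unification unfolds the nested actions. *)
move: gen_act_Neg gen_act_X gen_act_K gen_act_IH.
move: gen_act => act actN actX actK actIH.
case: r wfU.
(* The relations free of [IH]: all coefficients are rational. *)
1-21: clear hhK i_gt0; intros; split_neqs; eval_act actN actX actK.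
(* Position 0 must go: there [IH] yields [v 0 - v 0], so its square is not the identity. *)
all: case: i i_gt0 => // i _.
- by move=> _; case: (boolP (odd i.+1)) => ?;
    eval_act_IH actN actX actK actIH v hhK.
- move=> _; case: (boolP (odd i.+1)) => ?;
    (case: (eqVneq i.+1 1%N) => [->|?]; [|
     case: (eqVneq i.+1 2%N) => [->|?]; [|
     case: (eqVneq i.+1 3%N) => [->|?]; [|
     case: (eqVneq i.+1 4%N) => [->|?]]]]);
    try lia; eval_act_IH actN actX actK actIH v hhK.
- move=> _; case: (boolP (odd i.+1)) => ?;
    (case: (eqVneq i.+1 1%N) => [->|?]; [|
     case: (eqVneq i.+1 2%N) => [->|?]]);
    try lia; eval_act_IH actN actX actK actIH v hhK.
- move=> [//|a] ? _; case: (boolP (odd i.+1)) => ?;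
    (case: (eqVneq i.+1 a.+1%N) => [->|?]; [|
     case: (eqVneq i.+1 a.+2%N) => [->|?]]);
    try lia; eval_act_IH actN actX actK actIH v hhK.
(* The index is now [a.+2], and the swap straddles the pairs [a.+1], [a.+2] and [a.+3], [a.+4]:
   exactly the coordinates that [K] mixes. *)
- move=> [|[|a]] // ? _; case: (boolP (odd i.+1)) => ?;
    (case: (eqVneq i.+1 a.+1%N) => [->|?]; [|
     case: (eqVneq i.+1 a.+2%N) => [->|?]; [|
     case: (eqVneq i.+1 a.+3%N) => [->|?]; [|
     case: (eqVneq i.+1 a.+4%N) => [->|?]]]]);
    try lia; eval_act_IH actN actX actK actIH v hhK.
Qed.

(** The rightmost factor of a product acts first, hence [foldr]. *)
Lemma word_actP (n : nat) (W : word n) (v : nat -> R) (i : 'I_n) :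
  ~~ odd n ->
  \sum_j word_mx R W i j * v j.+1 = foldr gen_act v (map val W) i.+1.
Proof.
move=> en; elim: W i => [|g W IHW] i /=.
  rewrite /word_mx big_nil (bigD1 i) //= big1 ?addr0 => [|j nj].
    by rewrite mxE eqxx mul1r.
  by rewrite mxE eq_sym (negbTE nj) mul0r.
rewrite -gen_actP //; last exact: (valP g).
under [RHS]eq_bigr => k _ do rewrite -IHW mulr_sumr.
rewrite exchange_big; apply: eq_bigr => j _ /=.
rewrite /word_mx big_cons mxE mulr_suml.
by apply: eq_bigr => k _; rewrite mulrA.
Qed.

Lemma relation_word_mx (n : nat) (V W : word n) :
  ~~ odd n -> relation (map val V) (map val W) -> word_mx R V = word_mx R W.
Proof.
move=> en r; apply/matrixP=> i j.
(* The test vector is the basis vector at [j], whose image is column [j]. *)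
have entry (A : 'M[R]_n) : A i j = \sum_k A i k * (k.+1 == j.+1)%:R.
  rewrite (bigD1 j) //= eqxx mulr1 big1 ?addr0 // => k nk.
  by rewrite eqSS val_eqE (negbTE nk) mulr0.
rewrite !entry !(@word_actP n _ (fun k => (k == j.+1)%:R)) //.
apply: (relation_act (n := n)) => //.
by elim: V {r} => //= g V ->; rewrite andbT; exact: (valP g).
Qed.

End Action.

Theorem theorem5p4 (R : realType) (n : nat) (hn : (2 <= n)%N) (en : ~~ odd n)
    (G H : word n) :
  equiv_word G H -> same_mx R G H.
Proof.
(* Only the generating relations need computation; congruence holds because [word_mx] turns
   concatenation into product. *)
elim=> [V W|V|V W _|U V W _ UV _|V V' W W' _ VV' _ WW']; rewrite /same_mx //.
- exact: relation_word_mx.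
- by rewrite UV.
- by rewrite /word_mx !big_cat /= -!/(word_mx R _) VV' WW'.
Qed.
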